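(* Let $p$ be a prime, $Z$ a countable abelian group of finite exponent $p^s$, and $t,u\in\mathbb{N}$ with $s+t\ge u\ge s\ge t$, and also $u>t$ if $p=2$. Let $G$ be the countable comprehensive group in $\mathcal{N}_2(p^u,p^t/Z)$. Assume $Z$ contains an elementary abelian $p$-subgroup of rank $2$. Then $G$ is not pseudofinite.
   Context: For an abelian $p$-group $A$ and $g\in A$, $\mathrm{ht}_A(g)=\sup\{n\ge0: g=h^{p^n}\text{ for some }h\in A\}$; a subgroup $B\le A$ is pure if $\mathrm{ht}_B(g)=\mathrm{ht}_A(g)$ for all $g\in B$. $\mathcal{N}_2(p^u,p^t/Z)$ is the class of nilpotent class-$2$ groups $G$ of exponent $p^u$ with centre $Z$ such that $G^*=G/Z$ has exponent $p^t$; for $g\in G$, $g^*$ is its image in $G^*$ and $|g|$ its order. A nilpotent class-$2$ $p$-group $G$ with centre $Z$ is comprehensive if: whenever $A$ is a finite pure subgroup of $G^*$, $\alpha\in\mathrm{Hom}(A,Z)$, $w\in Z$, $r\in\mathbb{N}$ with $\exp(\alpha(A))\le p^r\le\exp(G^* )$ and $p^r|w|\le\exp(G)$, there is $g\in G$ such that $\langle A,g^*\rangle$ is pure in $G^*$, $|g^*|=p^r$, $g^{p^r}=w$, and $[a,g^*]=\alpha(a)$ for all $a\in A$ (the commutator being well defined on $G^*$). By a theorem of Apps, under the stated conditions there is a unique countable comprehensive group in $\mathcal{N}_2(p^u,p^t/Z)$, and it is $\omega$-categorical. A structure is pseudofinite if it is infinite and every sentence true in it has a finite model. *)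

(* Defs.v *)
From HB Require Import structures.
From mathcomp Require Import all_boot all_order all_algebra.
From mathcomp Require Import boolp classical_sets functions cardinality.

Set Implicit Arguments.
Unset Strict Implicit.
Unset Printing Implicit Defensive.

Local Open Scope classical_set_scope.
Local Open Scope group_scope.
Local Open Scope quotient_scope.

(* The extended naturals N u {oo}: [None] stands for oo. *)
Definition enat := option nat.

Definition le_enat (x y : enat) : bool :=
  if y is Some n then (if x is Some m then (m <= n)%N else false) else true.

Definition enat_inf (S : set nat) : enat :=
  if pselect (exists n, `[< S n >]) is left ex then Some (ex_minn ex) else None.

Definition enat_sup (S : set nat) : enat :=
  enat_inf [set n | forall m, S m -> (m <= n)%N].

Section Groups.
Variable G : groupType.
Implicit Types (x y g : G) (A B S : set G).

Definition subgroup A : Prop := group_closed (mem A).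

Definition gen_subgroup S : set G := smallest subgroup S.

Definition center : set G := [set x | forall y, commute x y].

Definition elt_order g : enat := enat_inf [set n | (0 < n)%N /\ g ^+ n = 1].

Definition exponent A : enat :=
  enat_inf [set n | (0 < n)%N /\ forall g, A g -> g ^+ n = 1].

(* [lower_central n] is the term usually written gamma_{n+1}. *)
Fixpoint lower_central (n : nat) : set G :=
  if n is n'.+1 then
    gen_subgroup [set [~ x, y] | x in lower_central n' & y in [set: G]]
  else setT.

(* The class is exactly [c]: in particular class 2 excludes abelian groups. *)
Definition nilpotent_of_class (c : nat) : Prop :=
  lower_central c = [set 1] /\
  forall n, lower_central n = [set 1] -> (c <= n)%N.

Definition height (p : nat) A g : enat :=
  enat_sup [set n | exists2 h, A h & g = h ^+ (p ^ n)].

(* Purity of [B] in the whole group. *)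
Definition pure_subgroup (p : nat) B : Prop :=
  subgroup B /\ forall g, B g -> height p B g = height p [set: G] g.

Definition elementary_abelian_of_rank (p r : nat) (E : set G) : Prop :=
  exists f : 'rV['F_p]_r -> G,
    {morph f : u v / (u + v)%R >-> u * v} /\ set_bij [set: 'rV['F_p]_r] E f.

End Groups.

Arguments center : clear implicits.

Section CentralQuotient.
Variable G : groupType.
Implicit Types x y z : G.

Definition eq_center x y : bool := `[< center G (x^-1 * y) >].

Lemma center1 : center G 1.
Proof. by move=> y; rewrite /commute mul1g mulg1. Qed.

Lemma centerM x y : center G x -> center G y -> center G (x * y).
Proof.
by move=> cx cy z; rewrite /commute -mulgA (cy z) mulgA (cx z) mulgA.
Qed.

Lemma centerV x : center G x -> center G x^-1.
Proof. by move=> cx z; apply/commute_sym/commuteV/commute_sym/cx. Qed.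

Lemma eq_centerP x y :
  reflect (exists2 z, center G z & y = x * z) (eq_center x y).
Proof.
apply: (iffP (asboolP _)) => [cxy|[z cz ->]]; last by rewrite mulKg.
by exists (x^-1 * y) => //; rewrite mulVKg.
Qed.

Lemma eq_center_refl : reflexive eq_center.
Proof. by move=> x; apply/eq_centerP; exists 1; [exact: center1|rewrite mulg1]. Qed.

Lemma eq_center_sym : symmetric eq_center.
Proof.
suff H x y : eq_center x y -> eq_center y x by move=> x y; apply/idP/idP; exact: H.
case/eq_centerP=> z cz ->; apply/eq_centerP; exists z^-1; first exact: centerV.
by rewrite mulgK.
Qed.

Lemma eq_center_trans : transitive eq_center.
Proof.
move=> y x z /eq_centerP[a ca ->] /eq_centerP[b cb ->].
by apply/eq_centerP; exists (a * b); [exact: centerM|rewrite mulgA].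
Qed.

Canonical eq_center_equiv :=
  EquivRel eq_center eq_center_refl eq_center_sym eq_center_trans.

(* The quotient G* = G / Z(G). *)
Definition cquot : Type := {eq_quot eq_center_equiv}.
HB.instance Definition _ := Choice.on cquot.

Definition cproj (x : G) : cquot := \pi_{eq_quot eq_center_equiv} x.
Definition crepr (a : cquot) : G := repr (a : {eq_quot eq_center_equiv}).

Lemma creprK : cancel crepr cproj.
Proof. by move=> a; rewrite /cproj /crepr reprK. Qed.

Lemma cprojP x y : cproj x = cproj y <-> eq_center x y.
Proof. by split=> [/eqmodP|H]; [|apply/eqmodP]. Qed.

Definition cquot_mul (a b : cquot) : cquot := cproj (crepr a * crepr b).
Definition cquot_inv (a : cquot) : cquot := cproj (crepr a)^-1.
Definition cquot_one : cquot := cproj 1.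

Lemma crepr_proj x : exists2 z, center G z & crepr (cproj x) = x * z.
Proof. by apply/eq_centerP/cprojP; rewrite creprK. Qed.

Lemma cproj_mul x y : cproj (x * y) = cquot_mul (cproj x) (cproj y).
Proof.
have [a ca ea] := crepr_proj x; have [b cb eb] := crepr_proj y.
apply/cprojP/eq_centerP; exists (a * b); first exact: centerM.
by rewrite ea eb -!mulgA; congr (_ * _); rewrite !mulgA (ca y).
Qed.

Lemma cproj_inv x : cproj x^-1 = cquot_inv (cproj x).
Proof.
have [a ca ea] := crepr_proj x.
apply/cprojP/eq_centerP; exists a^-1; first exact: centerV.
by rewrite ea invgM (centerV ca).
Qed.

Fact cquot_mulA : associative cquot_mul.
Proof.
by move=> a b c; rewrite -(creprK a) -(creprK b) -(creprK c) -!cproj_mul mulgA.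
Qed.

Fact cquot_mul1 : left_id cquot_one cquot_mul.
Proof. by move=> a; rewrite -(creprK a) -cproj_mul mul1g. Qed.

Fact cquot_1mul : right_id cquot_one cquot_mul.
Proof. by move=> a; rewrite -(creprK a) -cproj_mul mulg1. Qed.

Fact cquot_mulV : left_inverse cquot_one cquot_inv cquot_mul.
Proof. by move=> a; rewrite -(creprK a) -cproj_inv -cproj_mul mulVg. Qed.

Fact cquot_Vmul : right_inverse cquot_one cquot_inv cquot_mul.
Proof. by move=> a; rewrite -(creprK a) -cproj_inv -cproj_mul mulgV. Qed.

HB.instance Definition _ := isGroup.Build cquot
  cquot_mulA cquot_mul1 cquot_1mul cquot_mulV cquot_Vmul.

End CentralQuotient.

Notation "x ^*" := (cproj x) : group_scope.

(* Membership of [G] in N_2(p^u, p^t / Z); the centre is identified with [Z]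
   through an isomorphism. *)
Definition in_N2 (p u t : nat) (Z G : groupType) : Prop :=
  [/\ nilpotent_of_class G 2,
      exponent [set: G] = Some (p ^ u)%N,
      exists f : {multiplicative Z -> G}, set_bij [set: Z] (center G) f &
      exponent [set: cquot G] = Some (p ^ t)%N].

(* [alpha] is only meaningful on [A], and [a, g^*] is [~ x, g] for any lift [x]
   of [a]. *)
Definition comprehensive (p : nat) (G : groupType) : Prop :=
  forall (A : set (cquot G)) (alpha : cquot G -> G) (w : G) (r : nat),
    finite_set A -> pure_subgroup p A ->
    (forall a, A a -> center G (alpha a)) ->
    (forall a b, A a -> A b -> alpha (a * b) = alpha a * alpha b) ->
    center G w ->
    le_enat (exponent (alpha @` A)) (Some (p ^ r)%N) ->
    le_enat (Some (p ^ r)%N) (exponent [set: cquot G]) ->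
    le_enat (omap (muln (p ^ r)) (elt_order w)) (exponent [set: G]) ->
    exists g : G,
      [/\ pure_subgroup p (gen_subgroup (A `|` [set g^*])),
          elt_order g^* = Some (p ^ r)%N,
          g ^+ (p ^ r) = w &
          forall x : G, A x^* -> [~ x, g] = alpha x^*].

(* First-order logic in the language of groups (1, *, ^-1). *)
Inductive term : Type :=
  | Var of nat
  | One
  | Mul of term & term
  | Inv of term.

Inductive formula : Type :=
  | Bot
  | Eq of term & term
  | Imp of formula & formula
  | And of formula & formula
  | Or of formula & formula
  | All of nat & formula
  | Ex of nat & formula.

Fixpoint term_vars (s : term) : seq nat :=
  match s with
  | Var i => [:: i]
  | One => [::]
  | Mul s1 s2 => term_vars s1 ++ term_vars s2
  | Inv s1 => term_vars s1
  end.

Fixpoint free_vars (phi : formula) : seq nat :=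
  match phi with
  | Bot => [::]
  | Eq s1 s2 => term_vars s1 ++ term_vars s2
  | Imp f1 f2 | And f1 f2 | Or f1 f2 => free_vars f1 ++ free_vars f2
  | All i f | Ex i f => [seq j <- free_vars f | j != i]
  end.

Definition sentence (phi : formula) : Prop := free_vars phi = [::].

(* A structure for this language, not assumed to satisfy the group axioms. *)
Record structure : Type := Structure {
  carrier :> Type;
  s_one : carrier;
  s_mul : carrier -> carrier -> carrier;
  s_inv : carrier -> carrier
}.

Section Semantics.
Variable M : structure.

Fixpoint eval (e : nat -> M) (s : term) : M :=
  match s with
  | Var i => e i
  | One => s_one M
  | Mul s1 s2 => s_mul (eval e s1) (eval e s2)
  | Inv s1 => s_inv (eval e s1)
  end.

Definition update (e : nat -> M) (i : nat) (x : M) : nat -> M :=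
  fun j => if j == i then x else e j.

Fixpoint sat (e : nat -> M) (phi : formula) : Prop :=
  match phi with
  | Bot => False
  | Eq s1 s2 => eval e s1 = eval e s2
  | Imp f1 f2 => sat e f1 -> sat e f2
  | And f1 f2 => sat e f1 /\ sat e f2
  | Or f1 f2 => sat e f1 \/ sat e f2
  | All i f => forall x, sat (update e i x) f
  | Ex i f => exists x, sat (update e i x) f
  end.

Definition models (phi : formula) : Prop := forall e : nat -> M, sat e phi.

End Semantics.

Definition pseudofinite (M : structure) : Prop :=
  infinite_set [set: M] /\
  forall phi, sentence phi -> models M phi ->
    exists N : structure, finite_set [set: N] /\ models N phi.

Definition group_structure (G : groupType) : structure :=
  @Structure G 1 (fun x y => x * y) (fun x => x^-1).

(* Main.v *)
(** In a group of class 2 let P be the set of [x] with [x ^+ p] central; the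
    commutator is then bilinear on P with values in the elements of order
    dividing [p] of the centre.  Fix central [w], [w'] of order [p] with [w']
    outside <w>.  Comprehensiveness applied to the pure subgroups spanned by one
    or two elements of order [p] and height 0 in G/Z yields the first-order
    property: for [x] in P not centralising P and [x'] in P, some [y] in P has
    [[x, y] = w'], and some [y] in P has [[x, y] = w] and [[x', y]] in <w>.
    A finite group cannot have this property.  Choose linear functionals [la],
    [mu] with values in F_p such that [la w = 0], [la w' <> 0], [mu w <> 0].  The
    form [la [x, y]] has the same radical on P as the commutator itself, so by
    finiteness every [mu [x, -]] is of the form [la [x', -]]; evaluating at the
    [y] given by the property for [x], [x'] gives [mu w = 0]. *)
From HB Require Import structures.
From mathcomp Require Import all_boot all_order all_algebra.
From mathcomp Require Import all_fingroup all_solvable all_character.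
Require Import Defs.
From mathcomp Require Import boolp classical_sets functions cardinality.

Set Implicit Arguments.
Unset Strict Implicit.
Unset Printing Implicit Defensive.

Import GRing.Theory.

Local Open Scope group_scope.

(** * Commutator calculus in groups of class at most 2 *)

Section ClassTwo.
Variable G : groupType.
Hypothesis comm_central : forall x y : G, center G [~ x, y].
Implicit Types x y z : G.

Lemma commMl x y z : [~ x * y, z] = [~ x, z] * [~ y, z].
Proof.
have -> : [~ x * y, z] = [~ x, z] ^ y * [~ y, z].
  by rewrite !commgEr conjgM mulgA -conjMg mulgK.
by rewrite conjgE comm_central mulKg.
Qed.

Lemma commMr x y z : [~ z, x * y] = [~ z, x] * [~ z, y].
Proof. by rewrite -invgR commMl invgM !invgR comm_central. Qed.

Lemma commXl x y n : [~ x ^+ n, y] = [~ x, y] ^+ n.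
Proof. by elim: n => [|n IHn]; rewrite ?comm1g // !expgS commMl IHn. Qed.

Lemma commXr x y n : [~ x, y ^+ n] = [~ x, y] ^+ n.
Proof. by elim: n => [|n IHn]; rewrite ?commg1 // !expgS commMr IHn. Qed.

Lemma comm_center x y : center G x -> [~ x, y] = 1.
Proof. by move=> cx; apply/eqP/commgP/cx. Qed.

Lemma comm_expg1 p x y : center G (x ^+ p) -> [~ x, y] ^+ p = 1.
Proof. by move=> /comm_center cx; rewrite -commXl. Qed.

(** [(x * y) ^+ p] need not be [x ^+ p * y ^+ p], but by bilinearity its commutator with [z] is
    [[~ x, z] ^+ p * [~ y, z] ^+ p]. *)
Lemma center_expgM p x y :
  center G (x ^+ p) -> center G (y ^+ p) -> center G ((x * y) ^+ p).
Proof.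
move=> cx cy z; apply/commgP/eqP.
rewrite commXl commMl expgMn; last exact: comm_central.
by rewrite !comm_expg1 ?mulg1.
Qed.

End ClassTwo.

(* For [x] with [x ^+ p] central, [y0] witnesses that [x] is outside the radical
   of the commutator form. *)
Definition separating_pair p (G : groupType) (w w' : G) : Prop :=
  [/\ w <> 1,
      ~ (exists2 c, c < p & w' = w ^+ c)%N,
      (exists x y, [/\ center G (x ^+ p), center G (y ^+ p) & [~ x, y] <> 1]) &
      forall x y0, center G (x ^+ p) -> center G (y0 ^+ p) -> [~ x, y0] <> 1 ->
        (exists2 y, center G (y ^+ p) & [~ x, y] = w') /\
        forall x', center G (x' ^+ p) ->
          exists y, [/\ center G (y ^+ p), [~ x, y] = w &
                      exists2 c, (c < p)%N & [~ x', y] = w ^+ c]].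

(** Centrality of commutators is included so that a finite model has it too. *)
Definition separating p (G : groupType) : Prop :=
  (forall x y : G, center G [~ x, y]) /\
  exists w w' : G, separating_pair p w w'.

(** * Finite groups: linear algebra over F_p *)

Section FiniteGroups.
Local Open Scope ring_scope.

(** Every column of [cokermx u] annihilates [u]; not all annihilate [v], which lies outside the span
    of [u]. *)
Lemma separating_functional (F : fieldType) n (u v : 'rV[F]_n) :
  ~~ (v <= u)%MS ->
  exists2 L : 'cV[F]_n, u *m L = 0 & v *m L != 0.
Proof.
rewrite submxE => /matrix0Pn[i [j nz]].
exists (col j (cokermx u)); first by rewrite colE mulmxA mulmx_coker mul0mx.
apply/negP => /eqP; rewrite colE mulmxA -colE => /matrixP/(_ i 0).
by rewrite mxE [RHS]mxE => /eqP; apply/negP.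
Qed.

Lemma finite_not_separating p (H : finGroupType) : prime p -> ~ separating p H.
Proof.
move=> p_pr [cc [w [w' [w1 w'w [x0 [y0 [Px0 Py0 xy0]]] sep]]]].
pose Z := 'Z([set: H])%G.
have cZZ : abelian Z by exact: center_abelian.
pose W := Group (group_Ldiv p cZZ).
have WP z : reflect (Defs.center H z /\ z ^+ p = 1)%g (z \in W).
  rewrite !inE; apply: (iffP andP) => [[/centP cz /eqP zp]|[cz ->]] //.
    by split=> // y; apply: cz; rewrite inE.
  by split=> //; apply/centP => y _; apply: cz.
have abW : p.-abelem W.
  rewrite abelemE // (abelianS _ cZZ) ?subsetIl //=.
  by apply/exponentP => z /WP[].
have comml x y : Defs.center H (x ^+ p)%g -> [~ x, y]%g \in W.
  by move=> px; apply/WP; split; [exact: cc | exact: comm_expg1].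
have commr x y : Defs.center H (y ^+ p)%g -> [~ x, y]%g \in W.
  by move=> py; rewrite -invgR groupV comml.
have [[y1 Py1 exy1] sep0] := sep _ _ Px0 Py0 xy0.
have Ww' : w' \in W by rewrite -exy1 comml.
have [y2 [Py2 exy2 _]] := sep0 _ Px0.
have Ww : w \in W by rewrite -exy2 comml.
have ntW : W != 1%G by apply/trivgPn; exists w => //; apply/eqP.
pose rV := abelem_rV abW ntW.
have rVM : {in W &, {morph rV : x y / (x * y)%g >-> x + y}} by exact: abelem_rV_M.
have rV0 : rV 1%g = 0 by exact: abelem_rV_1.
have rVX z n : z \in W -> rV (z ^+ n)%g = n%:R *: rV z by exact: abelem_rV_X.
have rVinj : {in W &, injective rV} by exact: abelem_rV_inj.
have nzw : ~~ (rV w <= rV 1%g)%MS.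
  rewrite rV0; apply/negP => /submx0null; rewrite -rV0 => /rVinj.
  by rewrite group1 => /(_ Ww isT).
have [mu _ muw] := separating_functional nzw.
have nzw' : ~~ (rV w' <= rV w)%MS.
  (* A scalar of F_p is the class of a natural number, so proportional rows would make [w'] a power
     of [w]. *)
  apply/negP => /sub_rVP[a].
  rewrite -[a in a *: _]natr_Zp -rVX // => /(rVinj _ _ Ww' (groupX _ Ww)) ew'.
  apply: w'w.
  exists (a %% p)%N; first by rewrite ltn_mod prime_gt0.
  by have [_ wp] := WP _ Ww; rewrite ew' (expg_mod _ wp).
have [la law law'] := separating_functional nzw'.
pose phi (L : 'cV_('dim W)) x y := (rV [~ x, y]%g *m L) 0 0.
have phiMr L x : Defs.center H (x ^+ p)%g ->
    {morph phi L x : y z / (y * z)%g >-> y + z}.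
  by move=> Px y z; rewrite /phi commMr // rVM ?comml // mulmxDl mxE.
have phi1r L x : phi L x 1%g = 0 by rewrite /phi commg1 rV0 mul0mx mxE.
have phiXr L x y n : Defs.center H (x ^+ p)%g ->
    phi L x (y ^+ n)%g = n%:R * phi L x y.
  by move=> Px; rewrite /phi commXr // rVX ?comml // -scalemxAl mxE.
have phiMl L y : Defs.center H (y ^+ p)%g ->
    {morph phi L^~ y : x z / (x * z)%g >-> x + z}.
  by move=> Py x z; rewrite /phi commMl // rVM ?commr // mulmxDl mxE.
have phi1l L x : phi L 1%g x = 0 by rewrite /phi comm1g rV0 mul0mx mxE.
have phiXl L x y n : Defs.center H (y ^+ p)%g ->
    phi L (x ^+ n)%g y = n%:R * phi L x y.
  by move=> Py; rewrite /phi commXl // rVX ?commr // -scalemxAl mxE.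
pose P := [set x : H | `[< Defs.center H (x ^+ p)%g >]].
pose e (i : 'I_#|P|) : H := enum_val i.
have Pe i : Defs.center H (e i ^+ p)%g by have := enum_valP i; rewrite inE => /asboolP.
have eP x : Defs.center H (x ^+ p)%g -> exists i, e i = x.
  move=> Px; have xP : x \in P by rewrite inE; apply/asboolP.
  by exists (enum_rank_in xP x); rewrite /e enum_rankK_in.
(* [g] realises a vector of coefficients as an element of [P]; the forms [phi L] turn the product
   into a linear combination. *)
pose g (u : 'I_#|P| -> 'F_p) := (\prod_j e j ^+ u j)%g.
have Pg u : Defs.center H (g u ^+ p)%g.
  rewrite /g; elim/big_rec: _ => [|j y _ Py]; first by rewrite expg1n; exact: center1.
  apply: center_expgM => // y'; rewrite -expgM mulnC expgM.
  exact/commute_sym/commuteX/commute_sym/Pe.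
have phigr L x u : Defs.center H (x ^+ p)%g ->
    phi L x (g u) = \sum_j phi L x (e j) * u j.
  move=> Px; rewrite /g (big_morph _ (phiMr L x Px) (phi1r L x)).
  by apply: eq_bigr => j _; rewrite phiXr // natr_Zp mulrC.
have phigl L y u : Defs.center H (y ^+ p)%g ->
    phi L (g u) y = \sum_j u j * phi L (e j) y.
  move=> Py; rewrite /g (big_morph _ (phiMl L y Py) (phi1l L y)).
  by apply: eq_bigr => j _; rewrite phiXl // natr_Zp.
pose B L := \matrix_(i, j) phi L (e i) (e j).
(* Row spaces are compared through right annihilators: a vector [u] is
   annihilated by [B la] iff [g u] lies in the radical of the commutator form. *)
have sB : (B mu <= B la)%MS.
  rewrite submxE; apply/eqP/matrixP => i k; rewrite [RHS]mxE.
  set u := fun j => cokermx (B la) j k.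
  have ->: (B mu *m cokermx (B la)) i k = phi mu (e i) (g u).
    by rewrite phigr // !mxE; apply: eq_bigr => j _; rewrite mxE.
  have gla y : Defs.center H (y ^+ p)%g -> phi la y (g u) = 0.
    case/eP => l <-; rewrite phigr //.
    have /matrixP/(_ l k) := mulmx_coker (B la).
    by rewrite !mxE => {2}<-; apply: eq_bigr => j _; rewrite mxE.
  case: (eqVneq [~ e i, g u]%g 1%g) => [e1|/eqP ne1].
    by rewrite /phi e1 rV0 mul0mx mxE.
  have ne1' : [~ g u, e i]%g <> 1%g.
    by move=> e1; apply: ne1; rewrite -invgR e1 invg1.
  (* Some [y] would have [[~ g u, y] = w'], which [la] does not kill, although [gla] says that it
     kills [[~ y, g u]]. *)
  have [[y Py ey] _] := sep _ _ (Pg u) (Pe i) ne1'.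
  case/negP: law'; apply/eqP; rewrite -ey -invgR /rV abelem_rV_V ?comml //.
  rewrite mulNmx [X in - X](_ : _ = 0) ?oppr0 //.
  by apply/matrixP => a b; rewrite !ord1 [RHS]mxE; exact: gla.
have [i0 ei0] := eP _ Px0.
(* The coefficients [v] define the element [g (v 0)] that represents the functional [phi mu x0]
   through [la]. *)
have /submxP[v rowB] : (row i0 (B mu) <= B la)%MS := submx_trans (row_sub _ _) sB.
have phieq y : Defs.center H (y ^+ p)%g -> phi mu x0 y = phi la (g (v 0)) y.
  case/eP => l <-; rewrite phigl //; have /matrixP/(_ 0 l) := rowB.
  by rewrite !mxE ei0 => ->; apply: eq_bigr => j _; rewrite mxE.
have [y [Py exy [c _ egy]]] := sep0 _ (Pg (v 0)).
have := phieq _ Py; rewrite /phi exy egy rVX // -scalemxAl law scaler0 [RHS]mxE => e0.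
by case/negP: muw; apply/eqP/matrixP => a b; rewrite !ord1 e0 mxE.
Qed.

End FiniteGroups.

(** * First-order expression of the separating property *)

Section Sentences.

Fixpoint forall_all (s : seq nat) (phi : formula) : formula :=
  if s is i :: s' then All i (forall_all s' phi) else phi.

(** Closing a formula this way gives a sentence without computing the free variables of terms that
    depend on [p]. *)
Definition univ_closure (phi : formula) : formula :=
  forall_all (free_vars phi) phi.

Lemma sentence_univ_closure phi : sentence (univ_closure phi).
Proof.
have free_forall_all s : free_vars (forall_all s phi) =
    [seq j <- free_vars phi | j \notin s].
  elim: s => [|i s IHs] /=; first by rewrite filter_predT.
  by rewrite IHs -filter_predI; apply: eq_filter => j /=; rewrite inE negb_or.
rewrite /sentence free_forall_all (eq_in_filter (a2 := pred0)) ?filter_pred0 //.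
by move=> j ->.
Qed.

Lemma models_univ_closure (M : structure) phi :
  models M (univ_closure phi) <-> models M phi.
Proof.
rewrite /univ_closure; elim: (free_vars phi) => [|i s IHs] //=.
apply: iff_trans IHs; split=> [Mphi e | Mphi e x]; last exact: Mphi.
(* Updating [e] at [i] by its own value [e i] changes nothing. *)
have := Mphi e (e i); congr sat; apply/funext => j.
by rewrite /update; case: eqP => [->|].
Qed.

Definition tpow (s : Defs.term) n : Defs.term := iterop n Mul s One.

Definition tcomm (s1 s2 : Defs.term) : Defs.term :=
  Mul (Defs.Inv s1) (Mul (Defs.Inv s2) (Mul s1 s2)).

Definition neq_form (s1 s2 : Defs.term) : formula := Imp (Eq s1 s2) Bot.

(* Variable 9 is bound here, so it must not occur in [s]. *)
Definition central_form (s : Defs.term) : formula :=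
  All 9 (Eq (Mul s (Var 9)) (Mul (Var 9) s)).

(** A finite disjunction replaces the quantifier over exponents, which is not first-order. *)
Definition power_form p (s1 s2 : Defs.term) : formula :=
  foldr Or Bot [seq Eq s1 (tpow s2 c) | c <- iota 0 p].

(** A finite model is an arbitrary structure, so the sentence must itself impose the group
    axioms. *)
Definition group_form : formula :=
  And (All 0 (All 1 (All 2 (Eq (Mul (Var 0) (Mul (Var 1) (Var 2)))
                               (Mul (Mul (Var 0) (Var 1)) (Var 2))))))
 (And (All 0 (Eq (Mul One (Var 0)) (Var 0)))
      (All 0 (Eq (Mul (Defs.Inv (Var 0)) (Var 0)) One))).

(** Variables 0 and 1 stand for [w] and [w'], 2 and 3 for [x] and [y0], 4 for [y], 5 for [x']. *)
Definition separating_form p : formula :=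
  let pcentral i := central_form (tpow (Var i) p) in
  And (All 0 (All 1 (central_form (tcomm (Var 0) (Var 1)))))
  (Ex 0 (Ex 1
    (And (neq_form (Var 0) One)
    (And (Imp (power_form p (Var 1) (Var 0)) Bot)
    (And (Ex 2 (Ex 3 (And (pcentral 2) (And (pcentral 3)
            (neq_form (tcomm (Var 2) (Var 3)) One)))))
    (All 2 (All 3 (Imp (pcentral 2) (Imp (pcentral 3)
      (Imp (neq_form (tcomm (Var 2) (Var 3)) One)
      (And (Ex 4 (And (pcentral 4) (Eq (tcomm (Var 2) (Var 4)) (Var 1))))
      (All 5 (Imp (pcentral 5)
        (Ex 4 (And (pcentral 4) (And (Eq (tcomm (Var 2) (Var 4)) (Var 0))
          (power_form p (tcomm (Var 5) (Var 4)) (Var 0)))))))))))))))))).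

Section GroupSemantics.
Variable G : groupType.
Implicit Type e : nat -> group_structure G.

Lemma eval_tpow e s n : eval e (tpow s n) = (eval e s : G) ^+ n.
Proof. by rewrite /tpow; case: n => //; elim=> //= n ->. Qed.

Lemma sat_pcentral e i p : i != 9 ->
  sat e (central_form (tpow (Var i) p)) <-> center G ((e i : G) ^+ p).
Proof.
move=> ni9 /=; split=> c x; have := c x; rewrite !eval_tpow /= /update (negPf ni9);
  exact.
Qed.

Lemma sat_power e p s1 s2 :
  sat e (power_form p s1 s2) <->
  exists2 c, (c < p)%N & eval e s1 = (eval e s2 : G) ^+ c.
Proof.
rewrite /power_form; have ->: (exists2 c, (c < p)%N & eval e s1 = (eval e s2 : G) ^+ c)
  = (exists2 c, c \in iota 0 p & eval e s1 = (eval e s2 : G) ^+ c).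
  by apply/propext; split=> -[c cp]; exists c => //; rewrite mem_iota in cp *.
elim: (iota 0 p) => [|c s IHs] /=; first by split=> [|[]].
rewrite eval_tpow; split=> [[->|/IHs[d ds ->]]|[d]].
- by exists c; rewrite ?mem_head.
- by exists d; rewrite // inE ds orbT.
- by rewrite inE => /orP[/eqP-> ->|ds eqd]; [left | right; apply/IHs; exists d].
Qed.

Lemma sat_separating e p :
  sat e (separating_form p) <-> separating p G.
Proof.
split.
- case=> cc [w [w' [w1 [w'w [[x [y [Px [Py xy]]]] sep]]]]].
  split; first by move=> x' y'; exact: cc.
  exists w, w'; split=> //.
  + by move=> w'w_pow; apply: w'w; apply/sat_power.
  + by exists x, y; split=> //; [have /sat_pcentral := Px | have /sat_pcentral := Py];
      apply.
  move=> x1 y1 Px1 Py1 xy1; have [||//|[y2 [Py2 exy2]] sep'] := sep x1 y1.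
  + exact/sat_pcentral.
  + exact/sat_pcentral.
  split; first by exists y2 => //; have /sat_pcentral := Py2; apply.
  move=> x2 Px2; have [|y3 [Py3 [exy3 exy3']]] := sep' x2; first exact/sat_pcentral.
  exists y3; split=> //; first by have /sat_pcentral := Py3; apply.
  by have /sat_power := exy3'.
- case=> cc [w [w' [w1 w'w [x [y [Px Py xy]]] sep]]].
  split; first by move=> x' y' z; exact: cc.
  exists w, w'; split=> //; split; first by move=> /(@sat_power _ p (Var 1) (Var 0)).
  split.
    by exists x, y; split; [exact/sat_pcentral | split=> //; exact/sat_pcentral].
  move=> x1 y1 /sat_pcentral Px1 /sat_pcentral Py1 xy1.
  have [[y2 Py2 exy2] sep'] := sep x1 y1 (Px1 isT) (Py1 isT) xy1.
  split; first by exists y2; split=> //; exact/sat_pcentral.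
  move=> x2 /sat_pcentral Px2; have [y3 [Py3 exy3 exy3']] := sep' x2 (Px2 isT).
  exists y3; split; first exact/sat_pcentral.
  by split=> //; apply/sat_power.
Qed.

End GroupSemantics.

(** [H] is built on the carrier of [M] with the operations of [M], so the equality holds by
    conversion. *)
Lemma finite_group_structure (M : structure) :
  finite_set [set: M]%classic -> models M group_form ->
  exists H : finGroupType, M = group_structure H.
Proof.
case: M => T one mul inv finT ax.
pose T' := classicType T.
have /finite_seqP[s Ts] : finite_set [set: T']%classic by exact: finT.
have sT x : x \in s.
  have xs : [set` s]%classic x by rewrite -Ts.
  exact: xs.
have fins : Finite.axiom (undup s).
  move=> x; rewrite count_uniq_mem ?undup_uniq // mem_undup.
  by rewrite sT.
have [mulA [mul1 mulV]] := ax (fun=> one).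
have indexK : pcancel (index^~ s) (onth s).
  by move=> x; rewrite onthE (nth_map x) ?nth_index ?index_mem ?sT.
pose C : countType := HB.pack T' (PCanIsCountable indexK).
pose F : finType := HB.pack T' C (isFinite.Build T' fins).
pose H : finGroupType := HB.pack T' F (Finite_isGroup.Build F mulA mul1 mulV).
by exists H.
Qed.

End Sentences.

Lemma separating_not_pseudofinite p (G : groupType) :
  prime p -> separating p G -> ~ pseudofinite (group_structure G).
Proof.
move=> p_pr sepG [_ psf].
have [|N [finN /models_univ_closure NF]] :=
  psf _ (sentence_univ_closure (And group_form (separating_form p))).
  apply/models_univ_closure => e; split; last exact/sat_separating.
  by split; [move=> x y z; exact: mulgA | split=> x; [exact: mul1g | exact: mulVg]].
have [H eN] : exists H : finGroupType, N = group_structure H.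
  by apply: finite_group_structure => // e; case: (NF e).
rewrite {}eN in NF; apply: (@finite_not_separating p H p_pr).
by case: (NF (fun=> 1)) => _ /sat_separating.
Qed.

(** * Comprehensive groups have the separating property *)

Section Comprehensive.
Local Open Scope classical_set_scope.

Lemma le_enat_inf (S : set nat) n : S n -> le_enat (enat_inf S) (Some n).
Proof.
rewrite /enat_inf => Sn; case: pselect => [ex|[]]; last by exists n; apply/asboolP.
by rewrite /=; case: ex_minnP => m _; apply; apply/asboolP.
Qed.

Lemma enat_infP (S : set nat) n : enat_inf S = Some n -> S n.
Proof.
rewrite /enat_inf; case: pselect => // ex [<-].
by case: ex_minnP => m /asboolP.
Qed.

Lemma expgn_mod (G : groupType) (x : G) p i : x ^+ p = 1 -> x ^+ (i %% p) = x ^+ i.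
Proof.
move=> x1; rewrite [in RHS](divn_eq i p) expgnDr mulnC expgnA x1.
by rewrite expg1n mul1g.
Qed.

(** [l] is an inverse of [j] modulo [p], given by Bezout. *)
Lemma expgn_coprime_inv p j : prime p -> ~~ (p %| j)%N ->
  exists l, forall (G : groupType) (x : G), x ^+ p = 1 -> x ^+ (j * l) = x.
Proof.
move=> p_pr npj; have j0 : (0 < j)%N by case: j npj; rewrite ?dvdn0.
have [l k e _] := egcdnP p j0; exists l => G x x1.
have /eqP gcd1 : coprime j p by rewrite coprime_sym prime_coprime.
by rewrite mulnC e gcd1 addn1 expgSr mulnC expgnA x1 expg1n mul1g.
Qed.

Lemma prime_dvdn_expgn_eq1 p (G : groupType) (x : G) i :
  prime p -> x ^+ p = 1 -> x <> 1 -> x ^+ i = 1 -> (p %| i)%N.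
Proof.
move=> p_pr xp x1 xi; apply/negPn/negP => /(expgn_coprime_inv p_pr)[l /(_ G x xp)].
by rewrite expgnA xi expg1n => /esym.
Qed.

Lemma class2_comm_central (G : groupType) (x y : G) :
  nilpotent_of_class G 2 -> center G [~ x, y].
Proof.
case=> [G3 _] z; apply/commgP/eqP.
have : @lower_central G 2 [~ [~ x, y], z].
  apply: sub_gen_smallest; exists [~ x, y] => //; last by exists z.
  by apply: sub_gen_smallest; exists x => //; exists y.
by rewrite G3.
Qed.

(** If [t = 0], then [G] is its own centre, hence of class less than 2. *)
Lemma class2_exponent_cquot p t (G : groupType) :
  nilpotent_of_class G 2 -> exponent [set: cquot G] = Some (p ^ t)%N -> (0 < t)%N.
Proof.
move=> [_ G2] /enat_infP[_ expG]; rewrite lt0n; apply/eqP => t0.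
have Gab (x y : G) : commute x y.
  have /esym/cprojP/eq_centerP[z cz ->] : x ^* = 1 ^* by have := expG x^* I; rewrite t0.
  by rewrite mul1g; apply: cz.
suff /G2 : @lower_central G 1 = [set 1] by [].
apply/seteqP; split=> [x|_ ->] /=.
  move=> sx; apply: (sx [set 1]); split=> [|_ [y _ [z _ <-]]]; last first.
    exact/eqP/commgP/Gab.
  split=> [|y z]; rewrite ?inE // => -> ->.
  by rewrite /= invg1 mulg1.
by move=> A [[A1 _] _]; rewrite inE in A1.
Qed.

Section Cquot.
Variable G : groupType.
Implicit Types x y : G.

Lemma cprojM x y : (x * y) ^* = x ^* * y ^*.
Proof. exact: cproj_mul. Qed.

Lemma cprojX x n : (x ^+ n) ^* = x ^* ^+ n.
Proof. by elim: n => // n IHn; rewrite !expgS cprojM IHn. Qed.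

Lemma cproj_eq1 x : x ^* = 1 <-> center G x.
Proof.
have -> : (1 : cquot G) = (1 : G) ^* by [].
split=> [/esym/cprojP/eq_centerP[z cz ->] | cx]; first by rewrite mul1g.
by apply/esym/cprojP/eq_centerP; exists x; rewrite ?mul1g.
Qed.

End Cquot.

(* The last hypothesis makes every nontrivial element of <x^*, x'^*> of height 0,
   whence purity of this subgroup, and makes x |-> w, x' |-> 1 well defined on it.
   It holds with [x = x' = w = 1]. *)
Lemma comprehensive_extend p u t (G : groupType) (x x' w : G) :
  prime p -> (0 < t <= u)%N ->
  (forall y z : G, center G [~ y, z]) ->
  exponent [set: G] = Some (p ^ u)%N ->
  exponent [set: cquot G] = Some (p ^ t)%N ->
  comprehensive p G ->
  center G w -> w ^+ p = 1 -> center G (x ^+ p) -> center G (x' ^+ p) ->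
  (forall i j h, x ^* ^+ i * x' ^* ^+ j = h ^+ p ->
     w ^+ i = 1 /\ x ^* ^+ i * x' ^* ^+ j = 1) ->
  exists y, [/\ center G (y ^+ p), [~ x, y] = w, [~ x', y] = 1 &
              forall h, y ^* <> h ^+ p].
Proof.
move=> p_pr /andP[t0 tu] cc expG expQ compr cw wp px px' indep.
have commQ (a b : cquot G) : commute a b.
  rewrite -(creprK a) -(creprK b) /commute -!cprojM; apply/cprojP/eq_centerP.
  exists [~ crepr a, crepr b]^-1; first exact/centerV/cc.
  by rewrite [crepr a * _]commgC mulgK.
pose m i j := x ^* ^+ i * x' ^* ^+ j.
have mM i j k l : m i j * m k l = m (i + k)%N (j + l)%N.
  by rewrite /m !expgnDr !mulgA; congr (_ * _); rewrite -!mulgA (commQ (x' ^* ^+ j)).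
have x1 : x ^* ^+ p = 1 by rewrite -cprojX; apply/cproj_eq1.
have x'1 : x' ^* ^+ p = 1 by rewrite -cprojX; apply/cproj_eq1.
have mod_m i j : m (i %% p)%N (j %% p)%N = m i j by rewrite /m !expgn_mod.
have m1 : m 0%N 0%N = 1 by rewrite /m !expg0 mul1g.
(* With natural exponents, [p.-1] plays the role of -1 modulo [p]. *)
have mV i j : (m i j)^-1 = m (i * p.-1)%N (j * p.-1)%N.
  have inj : m i j * m (i * p.-1)%N (j * p.-1)%N = 1.
    by rewrite mM -!mulnS prednK ?prime_gt0 // -mod_m !modnMl m1.
  by rewrite -[LHS]mulg1 -inj mulKg.
pose A : set (cquot G) := [set a | exists i j, a = m i j].
pose alpha (a : cquot G) : G := xget 1 [set z | exists i j, a = m i j /\ z = w ^+ i].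
have alphaE i j : alpha (m i j) = w ^+ i.
  rewrite /alpha; case: xgetP => [z _ [k [l [emm ->]]]|/(_ (w ^+ i))[]]; last first.
    by exists i, j.
  have : m i j * (m k l)^-1 = 1 by rewrite emm mulgV.
  rewrite mV mM => e1.
  (* The quotient of two expressions of one element is 1, the [p]-th power of 1, so [indep] gives
     [w ^+ i = w ^+ k]. *)
  have := indep (i + k * p.-1)%N (j + l * p.-1)%N 1.
  rewrite -/(m _ _) e1 expg1n => /(_ erefl)[wik _].
  have : w ^+ (i + k * p.-1) * w ^+ k = w ^+ k.
    by rewrite wik mul1g.
  rewrite -expgnDr -addnA -mulnSr prednK ?prime_gt0 //.
  by rewrite expgnDr mulnC expgnA wp expg1n mulg1.
have finA : finite_set A.
  apply: (@sub_finite_set _ _ ((fun ij : 'I_p * 'I_p => m ij.1 ij.2) @` setT)).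
    move=> _ [i [j ->]].
    have lt_mod k : (k %% p < p)%N by rewrite ltn_mod prime_gt0.
    by exists (Ordinal (lt_mod i), Ordinal (lt_mod j)); rewrite //= mod_m.
  exact/finite_image/finite_finset.
have sgA : subgroup A.
  split; first by rewrite inE; exists 0%N, 0%N.
  move=> a b; rewrite !inE => -[i [j ->]] [k [l ->]].
  by rewrite mV mM; eexists; eexists.
have pureA : pure_subgroup p A.
  split=> // g [i [j eg]]; rewrite /height; congr enat_sup.
  apply/seteqP; split=> n [h _ egh]; first by exists h.
  case: n egh => [|n] egh; first by exists h => //; exists i, j; rewrite -eg egh expg1.
  (* An element of [A] that is a [p]-th power is 1, hence a power of 1 inside [A]. *)
  have [|_ g1] := indep i j (h ^+ (p ^ n)).
    by rewrite -/(m _ _) -eg egh expnSr expgnA.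
  by exists 1; [exists 0%N, 0%N | rewrite eg /m g1 expg1n].
(* Taking 1 for the central element and [r = 1] gives [g ^+ p = 1] with image of order [p]. *)
have [||||||g [pureB og gp gA]] := compr A alpha 1 1%N finA pureA.
- by move=> _ [i [j ->]]; rewrite alphaE => z; apply/commute_sym/commuteX/commute_sym.
- by move=> _ _ [i [j ->]] [k [l ->]]; rewrite mM !alphaE expgnDr.
- exact: center1.
- apply: le_enat_inf; split; first by rewrite expn_gt0 prime_gt0.
  by move=> _ [_ [i [j ->]] <-]; rewrite alphaE -expgnA mulnC expgnA wp expg1n.
- by rewrite expQ /= leq_pexp2l // prime_gt0.
- rewrite expG; have := @le_enat_inf [set n | (0 < n)%N /\ (1 : G) ^+ n = 1] 1%N.
  rewrite -/(elt_order 1).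
  case: (elt_order _) => [n|] /(_ (conj isT (expg1n _ _))) //= n1.
  apply: leq_trans (leq_mul (leqnn _) n1) _.
  by rewrite muln1 leq_exp2l ?prime_gt1 // (leq_trans t0 tu).
have gp1 : g ^+ p = 1 by rewrite -[p]expn1.
have gQp : g ^* ^+ p = 1 by rewrite -cprojX gp1.
have gQ1 : g ^* <> 1.
  move=> g1; have := @le_enat_inf [set n | (0 < n)%N /\ g ^* ^+ n = 1] 1%N.
  rewrite -/(elt_order _) og /= expn1 => /(_ (conj isT g1)).
  by rewrite leqNgt prime_gt1.
pose B := gen_subgroup (A `|` [set g ^*]).
(* As [B] is killed by [p], the image of [g] has height 0 in [B], and by purity in the whole
   quotient. *)
have Bp b : B b -> b ^+ p = 1.
  move=> Bb; apply: (Bb [set a | a ^+ p = 1]); split.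
    split=> [|a c]; rewrite !inE /=; first exact: expg1n.
    by move=> ap cp; rewrite expgnFl // ap cp mulgV.
  move=> _ [[i [j ->]]|->] //=; rewrite /m expgMn // -!expgnA ![(_ * p)%N]mulnC.
  by rewrite !expgnA x1 x'1 !expg1n mulg1.
have gB : B g ^* by apply: sub_gen_smallest; right.
exists g; rewrite gp1; split; first exact: center1.
- have ex : x ^* = m 1%N 0%N by rewrite /m expg0 expg1 mulg1.
  by rewrite gA ex ?alphaE ?expg1 //; exists 1%N, 0%N.
- have ex : x' ^* = m 0%N 1%N by rewrite /m expg0 expg1 mul1g.
  by rewrite gA ex ?alphaE ?expg0 //; exists 0%N, 1%N.
move=> h gh; have [_ /(_ _ gB)] := pureB; rewrite -/B /height.
have le0 : le_enat (enat_sup [set n | exists2 h, B h & g ^* = h ^+ (p ^ n)]) (Some 0%N).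
  apply: le_enat_inf => n [b Bb]; case: n => // n.
  by rewrite expnS expgnA Bp // expg1n.
case: (enat_sup _) le0 => [[|n]|] //= _ /esym/enat_infP ub.
have /ub // : [set n | exists2 h, [set: cquot G] h & g ^* = h ^+ (p ^ n)] 1%N.
by exists h => //; rewrite expn1.
Qed.

(** An element of P that is a [p]-th power modulo the centre centralises P; this gives the
    independence required by [comprehensive_extend]. For the pair [x], [x'], either [[~ x', -]] is
    on P a fixed power of [[~ x, -]], and [x] alone determines a suitable [y], or the images of [x]
    and [x'] are independent modulo [p]-th powers, and [y] can be chosen with [[~ x', y] = 1]. *)
Lemma comprehensive_separating p u t (G : groupType) (w w' : G) :
  prime p -> (0 < t <= u)%N ->
  (forall y z : G, center G [~ y, z]) ->
  exponent [set: G] = Some (p ^ u)%N ->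
  exponent [set: cquot G] = Some (p ^ t)%N ->
  comprehensive p G ->
  center G w -> w ^+ p = 1 -> w <> 1 -> center G w' -> w' ^+ p = 1 ->
  ~ (exists2 c, c < p & w' = w ^+ c)%N ->
  separating p G.
Proof.
move=> p_pr tu cc expG expQ compr cw wp w1 cw' w'p w'w.
have extend x x' z := @comprehensive_extend p u t G x x' z p_pr tu cc expG expQ compr.
(* For a lift [k] of [h], [[~ k ^+ p, y] = [~ k, y ^+ p] = 1]. *)
have ppow_comm (x y : G) h : center G (y ^+ p) -> x ^* = h ^+ p -> [~ x, y] = 1.
  move=> py; rewrite -(creprK h) -cprojX => /esym/cprojP/eq_centerP[z cz ->].
  rewrite commMl // commXl // -commXr // [X in X * _](_ : _ = 1).
    by rewrite mul1g comm_center.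
  by rewrite -invgR comm_center // invg1.
have proj1 (x : G) i : center G (x ^+ p) -> (p %| i)%N -> x ^* ^+ i = 1.
  move=> px /dvdnP[q ->]; rewrite mulnC expgnA -cprojX.
  by move/cproj_eq1: px => ->; rewrite expg1n.
split=> //; exists w, w'; split=> //.
  (* Extending the trivial subgroup gives [x] of height 0 modulo the centre; extending its span
     gives [y] with [[~ x, y] = w]. *)
  have [|||||x [px _ _ xh]] := extend 1 1 1.
  - exact: center1.
  - exact: expg1n.
  - by rewrite expg1n; exact: center1.
  - by rewrite expg1n; exact: center1.
  - move=> i j h _; have -> : 1 ^* = 1 :> cquot G by [].
    by rewrite !expg1n mulg1.
  have [||y [py xy _ _]] := extend x 1 w cw wp px.
  - by rewrite expg1n; exact: center1.
  - have -> : 1 ^* = 1 :> cquot G by [].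
    move=> i j h; rewrite expg1n mulg1 => xih.
    suff pi : (p %| i)%N.
      by rewrite proj1 //; case/dvdnP: pi => q ->; rewrite mulnC expgnA wp expg1n.
    apply/negPn/negP => /(expgn_coprime_inv p_pr)[l lP].
    apply: (xh (h ^+ l)); rewrite expgnAC -xih -expgnA lP // -cprojX.
    exact/cproj_eq1.
  by exists x, y; rewrite xy.
move=> x y0 px py0 xy0.
have commp y : [~ x, y] ^+ p = 1 by exact: comm_expg1.
have dvd_i i : [~ x, y0] ^+ i = 1 -> (p %| i)%N by exact: prime_dvdn_expgn_eq1.
have ext1 z : center G z -> z ^+ p = 1 ->
    exists2 y, center G (y ^+ p) & [~ x, y] = z.
  move=> cz zp; have [||y [py xy _ _]] := extend x 1 z cz zp px.
  - by rewrite expg1n; exact: center1.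
  - have -> : 1 ^* = 1 :> cquot G by [].
    move=> i j h; rewrite expg1n mulg1 -cprojX => /(ppow_comm _ _ _ py0).
    rewrite commXl // => /dvd_i pi; rewrite cprojX proj1 //.
    by case/dvdnP: pi => q ->; rewrite mulnC expgnA zp expg1n.
  by exists y.
split=> [|x' px']; first exact: ext1.
have [[c cp xx']|indep] :=
    pselect (exists2 c, (c < p)%N &
      forall y, center G (y ^+ p) -> [~ x', y] = [~ x, y] ^+ c).
  have [y py xy] := ext1 w cw wp; exists y; split=> //.
  by exists c; rewrite // xx' // xy.
have [|y [py xy x'y _]] := extend x x' w cw wp px px'; last first.
  by exists y; split=> //; exists 0%N; rewrite ?prime_gt0.
move=> i j h; rewrite -!cprojX -cprojM => ppow.
have rel y : center G (y ^+ p) -> [~ x, y] ^+ i * [~ x', y] ^+ j = 1.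
  by move=> py; rewrite -!commXl // -commMl // (ppow_comm _ _ _ py ppow).
have pj : (p %| j)%N.
  apply/negPn/negP => /(expgn_coprime_inv p_pr)[l lP]; apply: indep.
  (* Solving [rel] for [[~ x', y]]: this exponent is [- i / j] modulo [p]. *)
  exists (i * l * p.-1 %% p)%N; first by rewrite ltn_mod prime_gt0.
  move=> y py; rewrite expgn_mod // expgnA.
  have x'p : [~ x', y] ^+ p = 1 by exact: comm_expg1.
  rewrite -[LHS](lP _ _ x'p) (expgnA [~ x', y] j l).
  have /mulg1_eq <- := rel y py.
  apply: (@mulgI _ ([~ x, y] ^+ (i * l))).
  rewrite -expgS prednK ?prime_gt0 // expgnAC commp expg1n.
  by rewrite expVgn expgnA mulgV.
have pi : (p %| i)%N.
  apply: dvd_i; have := rel _ py0; case/dvdnP: pj => q ->.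
  have x'p : [~ x', y0] ^+ p = 1 by exact: comm_expg1.
  by rewrite [(q * p)%N]mulnC (expgnA [~ x', y0]) x'p expg1n mulg1.
rewrite cprojM !cprojX !proj1 // mulg1; split=> //.
by case/dvdnP: pi => q ->; rewrite mulnC expgnA wp expg1n.
Qed.

End Comprehensive.

(** * Conclusion for the comprehensive group *)

Local Open Scope classical_set_scope.

Theorem theorem2p11 (p s t u : nat) (Z G : groupType)
  (p_prime : prime p)
  (Z_countable : countable [set: Z])
  (Z_abelian : forall x y : Z, x * y = y * x)
  (Z_exponent : exponent [set: Z] = Some (p ^ s)%N)
  (stu : [/\ (u <= s + t)%N, (s <= u)%N & (t <= s)%N])
  (p2 : p = 2 -> (t < u)%N)
  (G_countable : countable [set: G])
  (G_N2 : in_N2 p u t Z G)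
  (G_comprehensive : comprehensive p G)
  (Z_rank2 : exists E : set Z, elementary_abelian_of_rank p 2 E) :
  ~ pseudofinite (group_structure G).
Proof.
case: G_N2 => class2 expG [f [fZ finj _]] expQ.
case: Z_rank2 => E [v [vM [_ vinj _]]].
have t0 := class2_exponent_cquot class2 expQ.
have tu : (0 < t <= u)%N by case: stu => _ su ts; rewrite t0 (leq_trans ts).
pose F a : G := f (v a).
have FM : {morph F : a b / (a + b)%R >-> a * b} by move=> a b; rewrite /F vM gmulfM.
have F0 : F 0%R = 1 by apply: (@mulgI _ (F 0%R)); rewrite -FM addr0 mulg1.
have FX a n : F a ^+ n = F (a *+ n)%R.
  by elim: n => [|n IHn]; rewrite ?F0 // expgS IHn mulrS FM.
have Finj : injective F.
  by move=> a b /finj eqf; apply: vinj; rewrite ?inE //; apply: eqf; rewrite inE.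
have Fp a : F a ^+ p = 1.
  rewrite FX -F0; congr F; apply/rowP => i; rewrite mulmxnE mxE.
  by rewrite -mulr_natr pchar_Fp_0 // mulr0.
have Fcentral a : center G (F a) by apply: fZ.
(* The images of the two basis vectors of F_p^2 are independent, as [F] is injective. *)
pose w := F (delta_mx ord0 ord0); pose w' := F (delta_mx ord0 ord_max).
apply: (separating_not_pseudofinite p_prime).
apply: (@comprehensive_separating p u t G w w') => //.
- by move=> y z; exact: class2_comm_central.
- exact: Fcentral.
- exact: Fp.
- rewrite -F0 => /Finj/rowP/(_ ord0); rewrite !mxE /= => /eqP.
  by rewrite oner_eq0.
- exact: Fcentral.
- exact: Fp.
- case=> c _; rewrite FX => /Finj/rowP/(_ ord_max); rewrite mulmxnE !mxE /= mul0rn.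
  by move/eqP; rewrite oner_eq0.
Qed.
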